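(* Let $K$ be a field of characteristic zero and let $\mathcal{R}_2 = K(x,y)\langle D_x, D_y\rangle$ be the ring of linear differential operators in $D_x, D_y$ with coefficients in the rational function field $K(x,y)$. Let $I$ be a left ideal of $\mathcal{R}_2$. If $\mathcal{R}_2/I$ is a finite-dimensional (left) vector space over $K(x,y)$, then there exists a nonzero element in $I \cap K(x)\langle D_x, D_y\rangle$.
   Context: $K(x,y)$ is the field of rational functions in two variables $x,y$ over $K$. The ring $\mathcal{R}_2 = K(x,y)\langle D_x, D_y\rangle$ consists of finite sums $\sum_{i,j\ge 0} f_{ij} D_x^i D_y^j$ with uniquely determined coefficients $f_{ij}\in K(x,y)$ (i.e. it is free as a left $K(x,y)$-module on the monomials $D_x^iD_y^j$), with multiplication determined by $D_xD_y = D_yD_x$ and the rules $D_x f = f D_x + \frac{\partial f}{\partial x}$ and $D_y f = f D_y + \frac{\partial f}{\partial y}$ for all $f\in K(x,y)$. The subring $K(x)\langle D_x, D_y\rangle\subset\mathcal{R}_2$ consists of those operators all of whose coefficients $f_{ij}$ lie in $K(x)$, i.e. are free of $y$. *)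

(* Defs.v *)
From HB Require Import structures.
From mathcomp Require Import all_boot all_algebra.
From mathcomp Require Import boolp.
From mathcomp Require Import ring.

Set Implicit Arguments.
Unset Strict Implicit.
Unset Printing Implicit Defensive.

Import GRing.Theory.
Local Open Scope ring_scope.

Record derivation (A : nzRingType) := Derivation {
  der_fun :> A -> A;
  derD : {morph der_fun : a b / a + b};
  derM : forall a b, der_fun (a * b) = der_fun a * b + a * der_fun b }.

Section DerivationTheory.
Variables (A : nzRingType) (d : derivation A).

Lemma der0 : d 0 = 0.
Proof. by apply: (addrI (d 0)); rewrite -derD !addr0. Qed.

Lemma derN : {morph d : a / - a}.
Proof. by move=> a; apply: (addrI (d a)); rewrite -derD !subrr der0. Qed.

Lemma derB : {morph d : a b / a - b}.
Proof. by move=> a b; rewrite derD derN. Qed.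

Lemma der1 : d 1 = 0.
Proof.
by apply: (addrI (d 1)); rewrite addr0 -[in RHS](mulr1 1) derM mulr1 mul1r.
Qed.

Lemma der_sum I (r : seq I) (P : pred I) (F : I -> A) :
  d (\sum_(i <- r | P i) F i) = \sum_(i <- r | P i) d (F i).
Proof. exact: (big_morph _ (derD d) der0). Qed.

End DerivationTheory.

(* The quotient rule extends a derivation of R to Frac(R); frac_der_div shows
   that the choice of representative is irrelevant. *)
Section FractionDerivation.
Variables (R : idomainType) (d : derivation R).
Local Notation "x %:F" := (@FracField.tofrac R x).

Definition frac_der (f : {fraction R}) : {fraction R} :=
  let n := \n_(repr f) in let m := \d_(repr f) in
  (d n * m - n * d m)%:F / (m ^+ 2)%:F.

Lemma frac_reprE (f : {fraction R}) : f = (\n_(repr f))%:F / (\d_(repr f))%:F.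
Proof.
have d0 := denom_ratioP (repr f).
apply: (@mulIf _ (\d_(repr f))%:F); first by rewrite tofrac_eq0.
rewrite divfK ?tofrac_eq0 // -{1}[f]reprK.
unlock FracField.tofrac; rewrite -[LHS]FracField.pi_mul.
apply/eqmodP; rewrite /= FracField.equivfE /FracField.mulf /=.
by rewrite !numden_Ratio ?mulr1 ?oner_neq0 // mulrC.
Qed.

Lemma eq_frac (n m n' m' : R) : m != 0 -> m' != 0 ->
  (n%:F / m%:F == n'%:F / m'%:F) = (n * m' == n' * m).
Proof.
by move=> m0 m0'; rewrite eqr_div ?tofrac_eq0 // -!tofracM tofrac_eq.
Qed.

Lemma frac_der_div (n m : R) : m != 0 ->
  frac_der (n%:F / m%:F) = (d n * m - n * d m)%:F / (m ^+ 2)%:F.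
Proof.
move=> m0; set f := _ / _.
have m0' := denom_ratioP (repr f).
have /eqP := frac_reprE f; rewrite {1}/f eq_frac // => /eqP E.
rewrite /frac_der; apply/eqP; rewrite eq_frac ?expf_neq0 //; apply/eqP.
set n' := \n__ in E m0' *; set m' := \d__ in E m0' *.
have E' : d n * m' + n * d m' = d n' * m + n' * d m by rewrite -!derM E.
apply: (@mulIf _ m') => //.
have -> : (d n' * m' - n' * d m') * m ^+ 2 * m' =
  m' ^+ 2 * m * (d n' * m) - m' * m * (n' * m) * d m' by ring.
have -> : d n' * m = d n * m' + n * d m' - n' * d m by rewrite E'; ring.
have -> : m' ^+ 2 * m * (d n * m' + n * d m' - n' * d m) =
  m' ^+ 3 * m * d n + m' ^+ 2 * m * n * d m' - m' ^+ 2 * (n' * m) * d m by ring.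
by rewrite -E; ring.
Qed.

Lemma frac_derE (n : R) : frac_der n%:F = (d n)%:F.
Proof.
rewrite -[n%:F]divr1 -tofrac1 frac_der_div ?oner_neq0 //.
by rewrite der1 mulr0 subr0 mulr1 expr1n tofrac1 divr1.
Qed.

Lemma frac_derD : {morph frac_der : f g / f + g}.
Proof.
move=> f g; rewrite [f]frac_reprE [g]frac_reprE.
have := denom_ratioP (repr f); have := denom_ratioP (repr g).
move: (\n__) (\d__) (\n__) (\d__) => a b a' b' b0 b0'.
rewrite addf_div ?tofrac_eq0 // -!tofracM -tofracD !frac_der_div ?mulf_neq0 //.
rewrite addf_div ?tofrac_eq0 ?expf_neq0 // -!tofracM -tofracD.
apply/eqP; rewrite eq_frac ?mulf_neq0 ?expf_neq0 // derD !derM; apply/eqP.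
ring.
Qed.

Lemma frac_derM f g : frac_der (f * g) = frac_der f * g + f * frac_der g.
Proof.
rewrite [f]frac_reprE [g]frac_reprE.
have := denom_ratioP (repr f); have := denom_ratioP (repr g).
move: (\n__) (\d__) (\n__) (\d__) => a b a' b' b0 b0'.
rewrite mulf_div -!tofracM !frac_der_div ?mulf_neq0 // !mulf_div.
rewrite addf_div ?mulf_neq0 ?tofrac_eq0 ?expf_neq0 //.
rewrite -!tofracM -tofracD.
apply/eqP; rewrite eq_frac ?mulf_neq0 ?expf_neq0 // !derM; apply/eqP.
ring.
Qed.

Definition frac_derivation := Derivation frac_derD frac_derM.

End FractionDerivation.

Lemma frac_der_comm (R : idomainType) (d e : derivation R) :
  (forall a, d (e a) = e (d a)) ->
  forall f, frac_der d (frac_der e f) = frac_der e (frac_der d f).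
Proof.
move=> de f; rewrite [f]frac_reprE.
have := denom_ratioP (repr f); move: (\n__) (\d__) => a b b0.
rewrite !frac_der_div ?expf_neq0 //.
apply/eqP; rewrite eq_frac ?expf_neq0 // !derB !derM !de; apply/eqP.
by ring.
Qed.

(* The Ore extension A[D; d]: p : {poly A} stands for \sum_i p`_i D^i, with
   D a = a D + d a. *)
Definition ore (A : nzRingType) (d : derivation A) := {poly A}.

Section Ore.
Variables (A : nzRingType) (d : derivation A).

Local Notation ore := (ore d).

HB.instance Definition _ := GRing.Zmodule.on ore.

(* left multiplication by D, see oreXM *)
Definition ore_shift (p : {poly A}) : {poly A} := p * 'X + map_poly d p.

Definition ore_mul (p q : {poly A}) : {poly A} :=
  \sum_(i < size p) p`_i *: iter i ore_shift q.

Lemma coef_ore_shift p i :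
  (ore_shift p)`_i = (if i is j.+1 then p`_j else 0) + d p`_i.
Proof.
by rewrite coefD coefMX (coef_map_id0 _ _ (der0 d)); case: i.
Qed.

Lemma ore_shiftD : {morph ore_shift : p q / p + q}.
Proof.
move=> p q; apply/polyP => i.
rewrite coefD !coef_ore_shift !coefD derD.
by case: i => [|i]; rewrite ?coefD ?add0r ?addr0 // addrACA.
Qed.

Lemma ore_shift0 : ore_shift 0 = 0.
Proof. by apply: (addrI (ore_shift 0)); rewrite -ore_shiftD !addr0. Qed.

Lemma ore_shift_sum I (r : seq I) (P : pred I) (F : I -> {poly A}) :
  ore_shift (\sum_(i <- r | P i) F i) = \sum_(i <- r | P i) ore_shift (F i).
Proof. exact: (big_morph _ ore_shiftD ore_shift0). Qed.

Lemma ore_shiftZ a p : ore_shift (a *: p) = a *: ore_shift p + d a *: p.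
Proof.
apply/polyP => i; rewrite [RHS]coefD !coefZ !coef_ore_shift !coefZ derM.
rewrite mulrDr -addrA [a * d _ + _]addrC; congr (_ + _).
by case: i => [|i]; rewrite ?coefZ ?mulr0.
Qed.

Lemma iter_ore_shiftD n : {morph iter n ore_shift : p q / p + q}.
Proof. by elim: n => // n IH p q; rewrite !iterS IH ore_shiftD. Qed.

Lemma iter_ore_shift0 n : iter n ore_shift 0 = 0.
Proof. by elim: n => //= n ->; rewrite ore_shift0. Qed.

Lemma ore_mulE n (p q : {poly A}) : (size p <= n)%N ->
  ore_mul p q = \sum_(i < n) p`_i *: iter i ore_shift q.
Proof.
move=> le_pn; rewrite /ore_mul.
rewrite (big_ord_widen n (fun i => p`_i *: iter i ore_shift q) le_pn).
rewrite big_mkcond; apply: eq_bigr => i _; case: ltnP => // le_pi.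
by rewrite nth_default // scale0r.
Qed.

Lemma ore_mulDl : left_distributive ore_mul +%R.
Proof.
move=> p q r; set n := maxn (size p) (size q).
rewrite !(@ore_mulE n) ?leq_maxl ?leq_maxr ?size_polyD // -big_split.
by apply: eq_bigr => i _; rewrite coefD scalerDl.
Qed.

Lemma ore_mulDr : right_distributive ore_mul +%R.
Proof.
move=> p q r; rewrite -big_split; apply: eq_bigr => i _.
by rewrite iter_ore_shiftD scalerDr.
Qed.

Lemma ore_mul0l q : ore_mul 0 q = 0.
Proof. by rewrite /ore_mul size_poly0 big_ord0. Qed.

Lemma ore_mul_suml I (r : seq I) (P : pred I) (F : I -> {poly A}) q :
  ore_mul (\sum_(i <- r | P i) F i) q = \sum_(i <- r | P i) ore_mul (F i) q.
Proof.
exact: (big_morph (ore_mul^~ q) (fun p p' => ore_mulDl p p' q) (ore_mul0l q)).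
Qed.

Lemma ore_mulZl a p q : ore_mul (a *: p) q = a *: ore_mul p q.
Proof.
rewrite (@ore_mulE (size p)) ?size_scale_leq // scaler_sumr.
by apply: eq_bigr => i _; rewrite coefZ scalerA.
Qed.

Lemma ore_mul_shift p q : ore_mul (ore_shift p) q = ore_shift (ore_mul p q).
Proof.
rewrite /ore_shift ore_mulDl -/(ore_shift _) /ore_mul.
rewrite -!/(ore_mul _ _) (@ore_mulE (size p).+1) ?size_polyMXn //; last first.
  by apply: leq_trans (size_polyMleq _ _) _; rewrite size_polyX addn2.
rewrite (@ore_mulE (size p) (map_poly d p)); last exact: size_poly.
rewrite big_ord_recl coefMX /= scale0r add0r -big_split.
rewrite ore_shift_sum; apply: eq_bigr => i _.
by rewrite ore_shiftZ coefMX /= (coef_map_id0 _ _ (der0 d)).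
Qed.

Lemma ore_mulA : associative ore_mul.
Proof.
move=> p q r; rewrite {2}/ore_mul ore_mul_suml; apply: eq_bigr => i _.
rewrite ore_mulZl; congr (_ *: _).
by elim: (nat_of_ord i) => //= n ->; rewrite ore_mul_shift.
Qed.

Lemma ore_mulCl a q : ore_mul a%:P q = a *: q.
Proof.
by rewrite (@ore_mulE 1) ?size_polyC_leq1 // big_ord1 coefC eqxx.
Qed.

Lemma ore_mul1l : left_id 1%:P ore_mul.
Proof. by move=> p; rewrite ore_mulCl scale1r. Qed.

Lemma ore_shift_Xn n : ore_shift 'X^n = 'X^(n.+1).
Proof.
apply/polyP => i; rewrite coef_ore_shift !coefXn.
case: (i == n); rewrite ?der1 ?der0 addr0; case: i => [|i] //.
all: by rewrite coefXn eqSS.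
Qed.

Lemma iter_ore_shift1 n : iter n ore_shift 1%:P = 'X^n.
Proof. by elim: n => [|n /= ->]; rewrite ?expr0 ?ore_shift_Xn. Qed.

Lemma ore_mul1r : right_id 1%:P ore_mul.
Proof.
move=> p; rewrite -[RHS]coefK poly_def; apply: eq_bigr => i _.
by rewrite iter_ore_shift1.
Qed.

Lemma ore_1neq0 : 1%:P != 0 :> ore.
Proof. by rewrite polyC1 oner_neq0. Qed.

HB.instance Definition _ := GRing.Zmodule_isNzRing.Build ore
  ore_mulA ore_mul1l ore_mul1r ore_mulDl ore_mulDr ore_1neq0.

Definition oreC (a : A) : ore := a%:P.
Definition oreX : ore := 'X.

Lemma oreC_zmod : zmod_morphism oreC.
Proof. by move=> a b; apply: polyCB. Qed.

Lemma oreC_monoid : monoid_morphism oreC.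
Proof.
by split=> // a b; rewrite [RHS]ore_mulCl /oreC polyCM mul_polyC.
Qed.

HB.instance Definition _ := GRing.isZmodMorphism.Build A ore oreC oreC_zmod.
HB.instance Definition _ := GRing.isMonoidMorphism.Build A ore oreC oreC_monoid.

Lemma oreXM (p : ore) : oreX * p = ore_shift p.
Proof.
have -> : oreX = ore_shift 1%:P by rewrite (ore_shift_Xn 0) expr1.
by rewrite [LHS]ore_mul_shift ore_mul1l.
Qed.

Lemma oreX_C a : oreX * oreC a = oreC a * oreX + oreC (d a).
Proof.
rewrite oreXM [oreC a * _]ore_mulCl /ore_shift /oreC mul_polyC; congr (_ + _).
by apply/polyP => i; rewrite (coef_map_id0 _ _ (der0 d)) !coefC; case: eqP;
  rewrite ?der0.
Qed.

Lemma oreXn n : oreX ^+ n = 'X^n.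
Proof. by elim: n => // n IH; rewrite exprS IH oreXM ore_shift_Xn. Qed.

Lemma oreE (p : ore) : p = \sum_(i < size (p : {poly A})) oreC p`_i * oreX ^+ i.
Proof.
rewrite -[LHS]coefK poly_def; apply: eq_bigr => i _.
by rewrite oreXn [RHS]ore_mulCl.
Qed.

Lemma ore_coef_sum n (f : nat -> A) i :
  (\sum_(k < n) oreC (f k) * oreX ^+ k : ore)`_i = if (i < n)%N then f i else 0.
Proof.
rewrite -(coef_poly n f) poly_def.
rewrite (eq_bigr (fun k : 'I_n => f k *: 'X^k : ore)) // => k _.
by rewrite oreXn [LHS]ore_mulCl.
Qed.

End Ore.

Section CoefficientwiseDerivation.
Variables (A : nzRingType) (e : derivation A).

Lemma coef_map_der p i : (map_poly e p)`_i = e p`_i.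
Proof. exact: coef_map_id0 (der0 e). Qed.

Lemma map_derD : {morph map_poly e : p q / p + q}.
Proof.
by move=> p q; apply/polyP => i; rewrite coefD !coef_map_der coefD derD.
Qed.

Lemma map_derM p q :
  map_poly e (p * q) = map_poly e p * q + p * map_poly e q.
Proof.
apply/polyP => i; rewrite coefD coef_map_der !coefM der_sum -big_split.
by apply: eq_bigr => j _; rewrite !coef_map_der derM.
Qed.

Definition poly_derivation := Derivation map_derD map_derM.

Lemma map_der_sum I (r : seq I) (P : pred I) (F : I -> {poly A}) :
  map_poly e (\sum_(i <- r | P i) F i) = \sum_(i <- r | P i) map_poly e (F i).
Proof. exact: (der_sum poly_derivation). Qed.

Lemma map_derZ a p : map_poly e (a *: p) = e a *: p + a *: map_poly e p.
Proof. by apply/polyP => i; rewrite coefD !coefZ !coef_map_der coefZ derM. Qed.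

Variables (d : derivation A) (ed : forall a, e (d a) = d (e a)).

Lemma map_der_shift p :
  map_poly e (ore_shift d p) = ore_shift d (map_poly e p).
Proof.
apply/polyP => i; rewrite coef_map_der !coef_ore_shift derD !coef_map_der ed.
by case: i => [|i]; rewrite ?der0 ?coef_map_der.
Qed.

Definition ore_der (p : ore d) : ore d := map_poly e p.

Lemma ore_derD : {morph ore_der : p q / p + q}.
Proof. exact: map_derD. Qed.

Lemma ore_derM (p q : ore d) : ore_der (p * q) = ore_der p * q + p * ore_der q.
Proof.
rewrite -[ore_der p * q]/(ore_mul d (map_poly e p) q).
rewrite (@ore_mulE _ _ (size (p : {poly A}))); last exact: size_poly.
rewrite [LHS]map_der_sum -[RHS]big_split; apply: eq_bigr => i _ /=.
rewrite map_derZ coef_map_der; congr (_ + _ *: _).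
by elim: (nat_of_ord i) => //= n <-; rewrite map_der_shift.
Qed.

Lemma ore_derC a : ore_der (oreC d a) = oreC d (e a).
Proof.
by apply/polyP => i; rewrite coef_map_der !coefC; case: eqP; rewrite ?der0.
Qed.

Lemma ore_derX : ore_der (oreX d) = 0.
Proof.
by apply/polyP => i; rewrite coef_map_der coefX coef0; case: eqP;
  rewrite ?der1 ?der0.
Qed.

Definition ore_derivation : derivation (ore d) :=
  Derivation ore_derD ore_derM.

End CoefficientwiseDerivation.

Record leftIdeal (R : nzRingType) := LeftIdeal {
  ideal_set :> R -> Prop;
  ideal0 : ideal_set 0;
  idealD : forall a b, ideal_set a -> ideal_set b -> ideal_set (a + b);
  idealM : forall r a, ideal_set a -> ideal_set (r * a) }.

Section LeftQuotient.
Variables (R : nzRingType) (I : leftIdeal R).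

Definition ideal_pred : {pred R} := fun a => `[< I a >].

Lemma ideal_predP a : reflect (I a) (a \in ideal_pred).
Proof. exact: asboolP. Qed.

Lemma ideal_pred_zmod_closed : zmod_closed ideal_pred.
Proof.
split=> [|a b /ideal_predP Ia /ideal_predP Ib]; apply/ideal_predP.
  exact: ideal0.
by rewrite -[b]mul1r -mulNr; apply: idealD => //; apply: idealM.
Qed.

HB.instance Definition _ := GRing.isZmodClosed.Build R ideal_pred
  ideal_pred_zmod_closed.

Definition left_quot := Quotient.quot ideal_pred.
HB.instance Definition _ := GRing.Zmodule.on left_quot.

Definition left_scale (r : R) (u : left_quot) : left_quot :=
  \pi_(left_quot)%qT (r * repr u).

Definition left_class (a : R) : left_quot := \pi_(left_quot)%qT a.

Lemma left_class_zmod : zmod_morphism left_class.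
Proof. exact: raddfB. Qed.

HB.instance Definition _ := GRing.isZmodMorphism.Build R left_quot left_class
  left_class_zmod.

Lemma left_classP a b : left_class a = left_class b <-> I (a - b).
Proof.
split=> [/eqP|Iab].
  by rewrite -Quotient.idealrBE => /ideal_predP.
by apply/eqP; rewrite -Quotient.idealrBE; apply/ideal_predP.
Qed.

Lemma left_class_repr u : left_class (repr u) = u.
Proof. exact: reprK. Qed.

Lemma left_scale_class r a : left_scale r (left_class a) = left_class (r * a).
Proof.
apply/left_classP; rewrite -mulrBr; apply: idealM.
by apply/left_classP; rewrite left_class_repr.
Qed.

Lemma left_scaleA r s u : left_scale r (left_scale s u) = left_scale (r * s) u.
Proof. by rewrite -[u]left_class_repr !left_scale_class mulrA. Qed.

Lemma left_scale1 : left_id 1 left_scale.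
Proof. by move=> u; rewrite -[u]left_class_repr left_scale_class mul1r. Qed.

Lemma left_scaleDr : right_distributive left_scale +%R.
Proof.
move=> r u v; rewrite -[u]left_class_repr -[v]left_class_repr.
by rewrite -raddfD !left_scale_class mulrDr raddfD.
Qed.

Lemma left_scaleDl u : {morph left_scale^~ u : r s / r + s}.
Proof.
by move=> r s; rewrite -[u]left_class_repr !left_scale_class mulrDl raddfD.
Qed.

HB.instance Definition _ := GRing.Zmodule_isLmodule.Build R left_quot
  left_scaleA left_scale1 left_scaleDr left_scaleDl.

Lemma left_classZ r a : left_class (r * a) = r *: left_class a.
Proof. by rewrite -left_scale_class. Qed.

End LeftQuotient.

(* dim_F V is finite, where F acts on the left R-module V through iota. *)
Definition finite_dimensional (F : fieldType) (R : nzRingType)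
    (iota : {rmorphism F -> R}) (V : lmodType R) : Prop :=
  exists (n : nat) (b : 'I_n -> V),
    forall v : V, exists c : 'I_n -> F, v = \sum_(i < n) iota (c i) *: b i.

Section DifferentialOperators.
Variable K : fieldType.
Local Notation "p %:F" := (@FracField.tofrac {poly {poly K}} p).

(* K(x, y); the inner variable of K[x][y] is x, the outer one is y. *)
Definition ratfun2 := {fraction {poly {poly K}}}.
HB.instance Definition _ := GRing.Field.on ratfun2.

Definition deriv_derivation (A : nzRingType) : derivation {poly A} :=
  Derivation (@derivD A) (@derivM A).

Definition ddx : derivation ratfun2 :=
  frac_derivation (poly_derivation (deriv_derivation K)).
Definition ddy : derivation ratfun2 :=
  frac_derivation (deriv_derivation {poly K}).

Lemma ddy_ddx f : ddy (ddx f) = ddx (ddy f).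
Proof.
apply: frac_der_comm => p /=; apply/polyP => i.
by rewrite coef_deriv !(coef_map_id0 _ _ (deriv0 _)) coef_deriv derivMn.
Qed.

Lemma ddx_x : ddx ('X%:P)%:F = 1.
Proof.
rewrite [LHS]frac_derE /= -tofrac1; congr (_%:F).
by apply/polyP => i; rewrite (coef_map_id0 _ _ (deriv0 _)) -polyC1 !coefC;
  case: eqP; rewrite ?derivX ?deriv0.
Qed.

Lemma ddx_y : ddx 'X%:F = 0.
Proof.
rewrite [LHS]frac_derE /= -tofrac0; congr (_%:F).
by apply/polyP => i; rewrite (coef_map_id0 _ _ (deriv0 _)) coefX coef0;
  case: eqP; rewrite -?polyC1 ?derivC.
Qed.

Lemma ddy_x : ddy ('X%:P)%:F = 0.
Proof. by rewrite [LHS]frac_derE /= derivC tofrac0. Qed.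

Lemma ddy_y : ddy 'X%:F = 1.
Proof. by rewrite [LHS]frac_derE /= derivX tofrac1. Qed.

(* K(x, y)<Dx, Dy> = K(x, y)[Dx; d/dx][Dy; d/dy] *)
Definition diffop2 := ore (ore_derivation ddy_ddx).
HB.instance Definition _ := GRing.NzRing.on diffop2.

Definition diffop2C : ratfun2 -> diffop2 :=
  @oreC _ (ore_derivation ddy_ddx) \o @oreC _ ddx.
HB.instance Definition _ := GRing.RMorphism.on diffop2C.

Definition Dx : diffop2 := oreC _ (oreX ddx).
Definition Dy : diffop2 := oreX _.

(* the coefficient of Dx^i Dy^j *)
Definition diffop2_coef (P : diffop2) (i j : nat) : ratfun2 :=
  ((P : {poly (ore ddx)})`_j : {poly ratfun2})`_i.

Definition in_Kx (f : ratfun2) : Prop :=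
  exists p q : {poly K}, q != 0 /\ f = (p%:P)%:F / (q%:P)%:F.

Definition in_Kx_DxDy (P : diffop2) : Prop :=
  forall i j, in_Kx (diffop2_coef P i j).

Lemma Dx_Dy : Dx * Dy = Dy * Dx.
Proof. by rewrite /Dx /Dy oreX_C /= ore_derX rmorph0 addr0. Qed.

Lemma Dx_C f : Dx * diffop2C f = diffop2C f * Dx + diffop2C (ddx f).
Proof. by rewrite /Dx /diffop2C /= -!rmorphM oreX_C rmorphD rmorphM. Qed.

Lemma Dy_C f : Dy * diffop2C f = diffop2C f * Dy + diffop2C (ddy f).
Proof. by rewrite /Dy /diffop2C /= oreX_C /= ore_derC. Qed.

(* diffop2E and diffop2_coef_sum: the Dx^i Dy^j form a basis of the left
   K(x, y)-module diffop2. *)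
Lemma diffop2E (P : diffop2) :
  P = \sum_(j < size (P : {poly (ore ddx)}))
        \sum_(i < size ((P : {poly (ore ddx)})`_j : {poly ratfun2}))
          diffop2C (diffop2_coef P i j) * Dx ^+ i * Dy ^+ j.
Proof.
rewrite {1}[P]oreE; apply: eq_bigr => j _.
rewrite {1}[P`_j]oreE rmorph_sum mulr_suml; apply: eq_bigr => i _.
by rewrite rmorphM rmorphXn.
Qed.

Lemma diffop2_coef_sum m n (f : nat -> nat -> ratfun2) i j :
  diffop2_coef (\sum_(l < n) \sum_(k < m) diffop2C (f k l) * Dx ^+ k * Dy ^+ l)
    i j = if (i < m)%N && (j < n)%N then f i j else 0.
Proof.
pose g l := \sum_(k < m) oreC ddx (f k l) * oreX ddx ^+ k.
have -> : \sum_(l < n) \sum_(k < m) diffop2C (f k l) * Dx ^+ k * Dy ^+ l =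
    \sum_(l < n) oreC (ore_derivation ddy_ddx) (g l) * oreX _ ^+ l.
  apply: eq_bigr => l _; rewrite -mulr_suml rmorph_sum; congr (_ * _).
  by apply: eq_bigr => k _; rewrite rmorphM rmorphXn.
rewrite /diffop2_coef ore_coef_sum andbC; case: (j < n)%N; rewrite ?coef0 //.
exact: (ore_coef_sum ddx m (f^~ j)).
Qed.

End DifferentialOperators.

(* Main.v *)
(* Let b_1, ..., b_n span R_2/I over K(x,y), and let q in K[x][y] be a common
   denominator of the coordinates of the class of 1 and of all Dx b_k, Dy b_k.
   Each application of Dx or Dy costs one more factor q in the denominator and
   raises the y-degree of the numerators by a constant, so the classes of the
   N^2 operators Dx^i Dy^j with i, j < N have numerators of y-degree O(N) over
   q^(2N).  They thus lie in a K(x)-space of dimension O(N), and for large N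
   they are linearly dependent over K(x). *)

Require Import Defs.
From HB Require Import structures.
From mathcomp Require Import all_boot all_algebra.
From mathcomp Require Import ring zify.

Set Implicit Arguments.
Unset Strict Implicit.
Unset Printing Implicit Defensive.

Import GRing.Theory.
Local Open Scope ring_scope.

Local Notation "x %:F" := (@FracField.tofrac _ x).

(** * Clearing denominators and linear dependence over a domain *)

Lemma common_denominator (R : idomainType) (J : finType)
    (f : J -> {fraction R}) :
  exists2 q : R, q != 0 & exists a : J -> R, forall j, f j = (a j)%:F / q%:F.
Proof.
exists (\prod_j \d_(repr (f j))).
  by apply/prodf_neq0 => j _; exact: denom_ratioP.
exists (fun j => \n_(repr (f j)) * \prod_(i | i != j) \d_(repr (f i))) => j.
have r0 : \prod_(i | i != j) \d_(repr (f i)) != 0.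
  by apply/prodf_neq0 => i _; exact: denom_ratioP.
rewrite [LHS]frac_reprE [X in _ = _ / X%:F](bigD1 j) //=; apply/eqP.
rewrite eq_frac ?mulf_neq0 ?denom_ratioP //; apply/eqP.
move: (\prod_(i | _) _) => r; ring.
Qed.

(** A matrix with more rows than columns has a nonzero left kernel vector over the fraction field; a
    common denominator of its entries brings the relation into [R]. *)
Lemma linear_dependence (R : idomainType) (J L : finType) (a : J -> L -> R) :
  (#|L| < #|J|)%N ->
  exists c : J -> R, (exists j, c j != 0) /\
    forall l, \sum_j c j * a j l = 0.
Proof.
move=> ltLJ.
pose A := \matrix_(i < #|J|, l < #|L|) (a (enum_val i) (enum_val l))%:F.
have kerA : kermx A != 0.
  rewrite -mxrank_eq0 mxrank_ker subn_eq0 -ltnNge.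
  exact: leq_ltn_trans (rank_leq_col A) ltLJ.
have [u /sub_kermxP uA u0] := rowV0Pn kerA.
have [q q0 [c uE]] := common_denominator (fun j : 'I_#|J| => u 0 j).
exists (fun j => c (enum_rank j)); split.
  have /rV0Pn[i ui] := u0; exists (enum_val i); rewrite enum_valK.
  by apply: contraNneq ui => ci; rewrite uE ci tofrac0 mul0r.
move=> l; apply/eqP; rewrite -tofrac_eq0 rmorph_sum /=.
have := congr1 (fun B : 'rV_#|L| => q%:F * B 0 (enum_rank l)) uA.
rewrite !mxE mulr0 big_distrr /= => E; rewrite -[X in _ == X]E; apply/eqP.
rewrite (reindex_onto enum_val enum_rank) => [|j _]; last exact: enum_rankK.
apply: eq_big => [i|i _]; first by rewrite enum_valK eqxx.
rewrite mxE uE enum_valK !enum_rankK tofracM mulrA.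
by rewrite [_ / _]mulrC mulrA divff ?mul1r // tofrac_eq0.
Qed.

Lemma derX_mul (R : comNzRingType) (d : derivation R) (q : R) m :
  d (q ^+ m) * q = (q ^+ m * d q) *+ m.
Proof.
elim: m => [|m IH]; first by rewrite expr0 der1 mul0r mulr0n.
rewrite exprS derM mulrDl -[q * _ * q]mulrA IH mulrSr addrC mulrnAr mulrA.
by congr (_ + _); ring.
Qed.

(** For positive [m], the quotient rule produces a numerator sharing the factor [q ^+ (m - 1)] with
    the denominator [q ^+ (2 * m)]; after cancellation only one new factor [q] remains. *)
Lemma frac_der_divX (R : idomainType) (d : derivation R) (p q : R) m :
  q != 0 ->
  frac_der d (p%:F / (q ^+ m)%:F) =
    (q * d p - (p * d q) *+ m)%:F / (q ^+ m.+1)%:F.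
Proof.
move=> q0; rewrite frac_der_div ?expf_neq0 //; apply/eqP.
rewrite eq_frac ?expf_neq0 //; apply/eqP; rewrite mulrBl.
have -> : p * d (q ^+ m) * q ^+ m.+1 = p * (d (q ^+ m) * q) * q ^+ m.
  by rewrite exprS; ring.
rewrite mulrBl derX_mul -[in RHS]mulr_natr -[in LHS]mulr_natr !exprS; ring.
Qed.

Lemma size_polyM_leS (S : nzRingType) (p q : {poly S}) s t :
  (size p <= s.+1)%N -> (size q <= t.+1)%N -> (size (p * q)%R <= (s + t).+1)%N.
Proof.
move=> size_p size_q; apply: leq_trans (size_polyMleq _ _) _.
by rewrite -subn1 leq_subLR add1n -addSn -addnS leq_add.
Qed.

(** * Growth of denominators and degrees under a derivation *)

Section Growth.
Variables (S : idomainType) (R : nzRingType).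
Variables (iota : {rmorphism {fraction {poly S}} -> R}).
Variables (V : lmodType R) (n : nat) (b : 'I_n -> V).
Local Notation T := {poly S}.
Variables (q : T) (C : nat).
Hypotheses (q0 : q != 0) (size_q : (size q <= C.+1)%N).

Definition combination (m : nat) (p : 'I_n -> T) : V :=
  \sum_k iota ((p k)%:F / (q ^+ m)%:F) *: b k.

Lemma combination_linear (J : finType) m (c : J -> T) (p : J -> 'I_n -> T) :
  \sum_j iota (c j)%:F *: combination m (p j) =
  combination m (fun k => \sum_j c j * p j k).
Proof.
rewrite (eq_bigr _ (fun j _ => scaler_sumr _ _ _ _)) exchange_big.
apply: eq_bigr => k _; rewrite rmorph_sum mulr_suml rmorph_sum scaler_suml.
by apply: eq_bigr => j _; rewrite /= scalerA -rmorphM tofracM mulrA.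
Qed.

(** For [S = K[x]] the bound [s] concerns the degree in y only; the degree in x is left free. *)
Definition bounded_at (m s : nat) (v : V) : Prop :=
  exists2 p : 'I_n -> T, forall k, (size (p k) <= s.+1)%N & v = combination m p.

Lemma bounded_at_mulq m s v :
  bounded_at m s v -> bounded_at m.+1 (s + C) v.
Proof.
case=> p size_p ->; exists (fun k => q * p k).
  by move=> k; rewrite mulrC size_polyM_leS.
apply: eq_bigr => k _; rewrite exprS !tofracM -mulf_div.
by rewrite divff ?tofrac_eq0 // mul1r.
Qed.

Lemma bounded_at_le m m' v : (m <= m')%N ->
  bounded_at m (m * C) v -> bounded_at m' (m' * C) v.
Proof.
move=> /subnKC <-; elim: (m' - m)%N => [|e IH] Bv; first by rewrite addn0.
by rewrite addnS mulSnr; apply/bounded_at_mulq/IH.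
Qed.

Variables (D : R) (d : derivation T) (A : 'I_n -> 'I_n -> T).
Hypothesis D_C : forall f,
  D * iota f = iota f * D + iota (frac_der d f).
Hypothesis size_d : forall p : T, (size (d p) <= size p)%N.
Hypothesis Db : forall k, D *: b k = \sum_l iota ((A k l)%:F / q%:F) *: b l.
Hypothesis size_A : forall k l, (size (A k l) <= C.+1)%N.

(** By the Leibniz rule, [D] sends [f b_k] to [f (D b_k) + f' b_k]. The extra [q] comes from [Db] in
    the first term and from [frac_der_divX] in the second; each product of numerators gains degree
    at most [C]. *)
Lemma bounded_at_der m s v :
  bounded_at m s v -> bounded_at m.+1 (s + C) (D *: v).
Proof.
case=> p size_p ->.
exists (fun l => q * d (p l) - (p l * d q) *+ m + \sum_k p k * A k l).
  move=> l; apply: leq_trans (size_polyD _ _) _; rewrite geq_max; apply/andP.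
  split; last first.
    apply: leq_trans (size_sum _ _ _) _; apply/bigmax_leqP => k _.
    exact: size_polyM_leS.
  apply: leq_trans (size_polyD _ _) _; rewrite geq_max size_polyN.
  rewrite mulrC size_polyM_leS ?(leq_trans (size_d _)) //=.
  (* The [m]-fold multiple is a scaling by a constant, so the degree bound does not depend on
     [m]. *)
  rewrite -mulr_natr -polyC_natr mulrC mul_polyC.
  apply: leq_trans (size_scale_leq _ _) _.
  by rewrite size_polyM_leS ?(leq_trans (size_d _)).
rewrite /combination scaler_sumr.
transitivity (\sum_k (\sum_l iota ((p k * A k l)%:F / (q ^+ m.+1)%:F) *: b l
   + iota ((q * d (p k) - (p k * d q) *+ m)%:F / (q ^+ m.+1)%:F) *: b k)).
  apply: eq_bigr => k _; rewrite scalerA D_C scalerDl frac_der_divX //.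
  congr (_ + _); rewrite -scalerA Db scaler_sumr; apply: eq_bigr => l _.
  by rewrite scalerA -rmorphM mulf_div -!tofracM -exprSr.
rewrite big_split exchange_big /= -big_split; apply: eq_bigr => l _ /=.
rewrite [LHS]addrC [in RHS]tofracD [in RHS]mulrDl [in RHS]rmorphD.
rewrite [RHS]scalerDl; congr (_ + _).
by rewrite !rmorph_sum mulr_suml rmorph_sum scaler_suml.
Qed.

Lemma bounded_at_iter_der m i v :
  bounded_at m (m * C) v ->
  bounded_at (i + m) ((i + m) * C) (D ^+ i *: v).
Proof.
move=> Bv; elim: i => [|i IH]; first by rewrite expr0 scale1r.
by rewrite exprS -scalerA addSn mulSnr; apply: bounded_at_der.
Qed.

End Growth.

(** * Counting monomials against coefficients *)

Lemma left_class_mul3 (R : nzRingType) (I : leftIdeal R) (r s t : R) :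
  left_class I (r * s * t) = r *: (s *: (t *: left_class I 1)).
Proof. by rewrite -!left_classZ mulr1 mulrA. Qed.

Theorem proposition1p1 (K : fieldType) (charK : [pchar K] =i pred0)
    (I : leftIdeal (diffop2 K)) :
  finite_dimensional (@diffop2C K) (left_quot I) ->
  exists P : diffop2 K, [/\ P != 0, I P & in_Kx_DxDy P].
Proof.
case=> n [b span_b].
have [ax axE] := fin_all_exists (fun k => span_b (Dx K *: b k)).
have [ay ayE] := fin_all_exists (fun k => span_b (Dy K *: b k)).
have [u uE] := span_b (left_class I 1).
(* All coordinates are gathered in one finite family, so that a single [q] serves both derivations
   and the class of 1. *)
pose f (j : 'I_n * 'I_n + 'I_n * 'I_n + 'I_n) : ratfun2 K :=
  match j with
  | inl (inl kl) => ax kl.1 kl.2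
  | inl (inr kl) => ay kl.1 kl.2
  | inr k => u k
  end.
have [q q0 [a aE]] := common_denominator f.
pose C := maxn (size q) (\max_j size (a j)).
have size_q : (size q <= C.+1)%N by rewrite leqW // leq_maxl.
have size_a j : (size (a j) <= C.+1)%N.
  by rewrite leqW // (leq_trans _ (leq_maxr _ _)) // (leq_bigmax j).
(* The class of 1 already has denominator [q], whence [j + 1]. *)
have Bxy i j :
    bounded_at (@diffop2C K) b q (i + (j + 1)) ((i + (j + 1)) * C)
      (Dx K ^+ i *: (Dy K ^+ j *: left_class I 1)).
  pose dx := poly_derivation (deriv_derivation K).
  pose dy := deriv_derivation {poly K}.
  have BX := @bounded_at_iter_der _ _ (@diffop2C K) _ n b q C q0 size_q
    (Dx K) dx (fun k l => a (inl (inl (k, l)))) (@Dx_C K).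
  have BY := @bounded_at_iter_der _ _ (@diffop2C K) _ n b q C q0 size_q
    (Dy K) dy (fun k l => a (inl (inr (k, l)))) (@Dy_C K).
  (* Neither derivation raises the y-degree: [dx] acts on coefficients, [dy] lowers exponents. *)
  apply: BX => [p|k|k l|]; [exact: size_poly| |exact: size_a|].
    by rewrite axE; apply: eq_bigr => l _; rewrite -aE.
  apply: BY => [p|k|k l|].
  - exact: leq_trans (size_poly _ _) (leq_pred _).
  - by rewrite ayE; apply: eq_bigr => l _; rewrite -aE.
  - exact: size_a.
  exists (fun k => a (inr k)); first by move=> k; rewrite mul1n.
  by rewrite uE; apply: eq_bigr => k _; rewrite expr1 -aE.
(* [M] exceeds every [i + j + 1] with [i, j < N]. The choice of [N] gives [N * N > n * N * (2 *
   C).+1 >= n * (M * C).+1], the number of numerator coefficients. *)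
pose N := (n * (2 * C).+1).+1.
pose M := (2 * N)%N.
have Bij (ij : 'I_N * 'I_N) : exists p : 'I_n -> {poly {poly K}},
    (forall k, (size (p k) <= (M * C).+1)%N) /\
    Dx K ^+ ij.1 *: (Dy K ^+ ij.2 *: left_class I 1) =
      combination (@diffop2C K) b q M p.
  have leM : (ij.1 + (ij.2 + 1) <= M)%N.
    by have := ltn_ord ij.1; have := ltn_ord ij.2; rewrite /M; lia.
  by have [p ? ?] := bounded_at_le q0 size_q leM (Bxy ij.1 ij.2); exists p.
have [p pP] := fin_all_exists Bij.
have ltN : (n * (M * C).+1 < N * N)%N.
  suff lt e : e = (n * (2 * C).+1).+1 -> (n * (2 * e * C).+1 < e * e)%N.
    exact: lt.
  by clear; nia.
(* There is one equation for each basis index [k] and each power of y; its coefficients lie in K[x],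
   hence so do the [c ij]. *)
have [|c [[ij0 c0] c_rel]] := @linear_dependence _ _ _
  (fun ij (kl : 'I_n * 'I_(M * C).+1) => (p ij kl.1)`_kl.2).
  by rewrite !card_prod !card_ord.
pose g (i j : nat) : ratfun2 K := ((c (inord i, inord j))%:P)%:F.
pose P := \sum_(j < N) \sum_(i < N) diffop2C (g i j) * Dx K ^+ i * Dy K ^+ j.
have coefP := diffop2_coef_sum N N g.
exists P; split.
(* The monomials are independent, so the nonzero [c ij0] survives as a coefficient of [P]. *)
- apply: contraNneq c0 => P0; have := coefP ij0.1 ij0.2.
  rewrite -/P P0 !ltn_ord /= /g !inord_val /diffop2_coef !coef0.
  rewrite -surjective_pairing.
  by move/esym/eqP; rewrite tofrac_eq0 polyC_eq0.
- rewrite -[P]subr0; apply/left_classP; rewrite raddf0.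
  have -> : left_class I P =
      \sum_ij diffop2C ((c ij)%:P)%:F *: combination (@diffop2C K) b q M (p ij).
    rewrite /P exchange_big /= pair_bigA raddf_sum; apply: eq_bigr => ij _.
    have [_ <-] := pP ij; rewrite /g !inord_val -surjective_pairing.
    exact: left_class_mul3.
  rewrite combination_linear; apply: big1 => k _.
  suff -> : \sum_ij (c ij)%:P * p ij k = 0.
    by rewrite tofrac0 mul0r rmorph0 scale0r.
  apply/polyP => l; rewrite coef_sum coef0.
  have [ltl|lel] := ltnP l (M * C).+1.
    apply: etrans (c_rel (k, Ordinal ltl)); apply: eq_bigr => ij _.
    by rewrite coefCM.
  (* Beyond y-degree [M * C] every numerator has zero coefficients, so [c_rel] covers all that
     matters. *)
  apply: big1 => ij _; rewrite coefCM nth_default ?mulr0 //.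
  exact: leq_trans ((pP ij).1 k) lel.
- move=> i j; rewrite coefP.
  exists (if (i < N)%N && (j < N)%N then c (inord i, inord j) else 0), 1.
  rewrite oner_neq0 polyC1 tofrac1 divr1; split=> //; rewrite /g.
  by case: ifP => // _; rewrite polyC0 tofrac0.
Qed.
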